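(* Let $\mathrm{Pnest}_n(t)=\sum_{\mathbf a\in\mathcal{DP}(n)}t^{\mathrm{pnest}(\mathbf a)}$, and let $\mathrm{Pnest}^c_n(t)$ be the same sum restricted to those $\mathbf a\in\mathcal{DP}(n)$ with $\Gamma_{\mathbf a}$ connected. For all $n\ge 1$: (i) $[t]\mathrm{Pnest}_n(t)=2^{n-1}$ and $[t]\mathrm{Pnest}^c_n(t)=1$; (ii) $[t^2]\mathrm{Pnest}_n(t)=S(n,3)$ (Stirling number of the second kind, OEIS A000392) and $[t^2]\mathrm{Pnest}^c_n(t)=F_{2n-3}-1$, where $F_k$ is the $k$th Fibonacci number; (iii) if $i\ge\lceil (n+2)/4\rceil$, then $$[t^i]\mathrm{Pnest}_n(t)=\frac{4(2i+1)\,[8i(i+1)-3(n+1)]\,(2n+1)!}{(n-2i+1)!\,(n+2i+3)!};$$ in particular, for $n\ge1$, $[t^{\lceil n/2\rceil}]\mathrm{Pnest}_n(t)$ equals $1$ if $n$ is odd and $2(n-1)$ if $n$ is even; (iv) if $i>\lfloor (n+2)/4\rfloor$, then $$[t^i]\mathrm{Pnest}^c_n(t)=\frac{8i\,[8i^2(2n-1)-(6n^2+n-2)]\,(2n-2)!}{(n-2i+1)!\,(n+2i+1)!};$$ in particular, for $n\ge1$, $[t^{\lceil n/2\rceil}]\mathrm{Pnest}^c_n(t)$ equals $1$ if $n$ is odd and $2(n-2)$ if $n$ is even. Hence $$\bigl([t^i]\mathrm{Pnest}_n(t)\bigr)^2\ge [t^{i-1}]\mathrm{Pnest}_n(t)\cdot[t^{i+1}]\mathrm{Pnest}_n(t)\quad\text{if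 }\lceil (n+2)/4\rceil<i\le\lceil n/2\rceil,$$ and $$\bigl([t^i]\mathrm{Pnest}^c_n(t)\bigr)^2\ge [t^{i-1}]\mathrm{Pnest}^c_n(t)\cdot[t^{i+1}]\mathrm{Pnest}^c_n(t)\quad\text{if }\lfloor (n+2)/4\rfloor+1<i\le\lceil n/2\rceil.$$
   Context: $[t^i]p(t)$ denotes the coefficient of $t^i$ in $p(t)$. Fibonacci numbers: $F_0=0$, $F_1=1$, $F_{k}=F_{k-1}+F_{k-2}$, with $F_{-1}=1$. The reciprocal of the factorial of a negative integer is read as $0$. Write $[n]=\{1,\dots,n\}$. An area sequence of size $n$ is a sequence $\mathbf a=(a_1,\dots,a_n)$ of nonnegative integers with $a_i<i$ for all $i$ and $a_i\le a_{i-1}+1$ for all $i\ge 2$; $\mathcal{DP}(n)$ is the set of all of them. Each $\mathbf a\in\mathcal{DP}(n)$ defines a graph $\Gamma_{\mathbf a}$ (a unit interval graph) on $[n]$ with edges $\{j,i\}$ for $1\le j<i\le n$ with $i-a_i\le j$. If $\{i,j\}$ with $i<j$ is an edge then $\{i,i+1,\dots,j\}$ is a clique. A peak-edge of $\Gamma_{\mathbf a}$ is either an isolated vertex $i$ (put $j=i$) or an edge $\{i,j\}$, $i<j$, such that neither $\{i,j+1\}$ nor $\{i-1,j\}$ is an edge (pairs not contained in $[n]$ are not edges). The corresponding peak-clique is $\{i,i+1,\dots,j\}$. The peak-nesting of a vertex is the number of peak-cliques containing it, and $\mathrm{pnest}(\mathbf a)$ is the maximum of these numbers over all vertices.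
   Formalization: In (iv), the ''in particular'' value of the coefficient of t^{⌈n/2⌉} in Pnest^c_n is stated for n ≥ 1 with n ≠ 2; at n = 2 the printed value 2(n−2) = 0 is false, the true coefficient being 1, as (i) gives. *)

(* Defs.v *)
From HB Require Import structures.
From mathcomp Require Import all_boot all_order all_algebra.

Set Implicit Arguments.
Unset Strict Implicit.
Unset Printing Implicit Defensive.

Import GRing.Theory Num.Theory.

(* The vertex set {1, ..., n} is represented by 'I_n, vertex v being stored as
   v - 1.  All conditions below only compare indices or take differences of
   them, except a_i < i, which becomes [a i < i.+1].  Since a_i < i <= n, the
   values of an area sequence can be taken in 'I_n, so that area sequences form
   a finite type. *)
Definition DP (n : nat) : {set {ffun 'I_n -> 'I_n}} :=
  [set a : {ffun 'I_n -> 'I_n} |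
    [forall i : 'I_n, a i < i.+1] &&
    [forall i : 'I_n, forall j : 'I_n,
       (nat_of_ord i == j.+1) ==> (a i <= (a j).+1)]].

Section Graph.

Variables (n : nat) (a : {ffun 'I_n -> 'I_n}).

Definition edge : rel 'I_n :=
  fun u v => ((u < v) && (v - a v <= u)) || ((v < u) && (u - a u <= v)).

Definition isolated (i : 'I_n) : bool := [forall k, ~~ edge i k].

(* Quantifying over the vertices k with k = j + 1 (resp. k = i - 1), of which
   there is at most one, makes the condition vacuous when {i, j+1}
   (resp. {i-1, j}) is not contained in the vertex set. *)
Definition peak_edge (i j : 'I_n) : bool :=
  ((i == j) && isolated i) ||
  [&& i < j, edge i j,
      [forall k : 'I_n, (nat_of_ord k == j.+1) ==> ~~ edge i k] &
      [forall k : 'I_n, (k.+1 == nat_of_ord i) ==> ~~ edge k j]].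

Definition peak_clique (e : 'I_n * 'I_n) : {set 'I_n} :=
  [set k : 'I_n | e.1 <= k <= e.2].

Definition peak_cliques : {set {set 'I_n}} :=
  peak_clique @: [set e : 'I_n * 'I_n | peak_edge e.1 e.2].

Definition peak_nesting (v : 'I_n) : nat :=
  #|[set K in peak_cliques | v \in K]|.

Definition pnest : nat := \max_(v : 'I_n) peak_nesting v.

Definition graph_connected : bool :=
  [forall u : 'I_n, forall v : 'I_n, connect edge u v].

End Graph.

Definition Pnest (n : nat) : {poly int} :=
  (\sum_(a in DP n) 'X^(pnest a))%R.

Definition PnestC (n : nat) : {poly int} :=
  (\sum_(a in DP n | graph_connected a) 'X^(pnest a))%R.

Definition stirling2 (n k : nat) : nat :=
  #|[set P : {set {set 'I_n}} | partition P [set: 'I_n] & #|P| == k]|.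

Fixpoint fib (k : nat) : nat :=
  match k with
  | 0 => 0
  | 1 => 1
  | (k''.+1 as k').+1 => fib k' + fib k''
  end.

(* The extension of F_k = F_{k-1} + F_{k-2} to all integers; Negz m stands for
   -(m+1) and F_{-(m+1)} = (-1)^m F_{m+1}, so in particular F_{-1} = 1. *)
Definition fibz (k : int) : int :=
  match k with
  | Posz k => (fib k)%:Z
  | Negz m => ((-1) ^+ m * (fib m.+1)%:Z)%R
  end.

(* 1 / z!, read as 0 when z is negative. *)
Definition inv_fact (z : int) : rat :=
  match z with
  | Posz k => ((k`!)%:R^-1)%R
  | Negz _ => 0%R
  end.

(* The ceiling of m / d, for d > 0. *)
Definition ceil_div (m d : nat) : nat := (m + d.-1) %/ d.

(* Main.v *)
Require Import Defs.
From HB Require Import structures.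
From mathcomp Require Import all_boot all_order all_algebra.
From mathcomp Require Import zify ring lra.

Set Implicit Arguments.
Unset Strict Implicit.
Unset Printing Implicit Defensive.

Import GRing.Theory Num.Theory.

(** Put f v = v - a_v.  The peak-cliques are the intervals [f j, j] for which j is the last
    vertex or f (j+1) <> f j.  Reading the vertices from left to right, the peak-nesting goes
    down by 1 after each right end and up by 1 at each left end, so area sequences correspond
    to words of n - 1 pairs (right end at t, left end at t + 1), that is to walks from 1 to 1.
    Having pnest <= k confines the walk to [1, k]; connectedness also forbids the intermediate
    value 0 between the two halves of a pair.  Cutting each pair into two half steps gives a
    simple walk between two absorbing barriers, counted by the reflection principle.  When k
    is large compared with n only the first reflections contribute, and the coefficients of
    t^i are third differences of binomial coefficients.  For k <= 2 the walks are counted by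
    recursion. *)

(** * Words of pairs as confined walks *)

(* e = 1 forbids the value 0 after the first half step x - q (e = 0 allows it). *)
Fixpoint walk (e k x : nat) (w : seq (bool * bool)) : bool :=
  if w is (q, p) :: w' then
    [&& q + e <= x, 0 < x - q + p <= k & walk e k (x - q + p) w']
  else x == 1.

(** The trajectory [X] is described by an additive relation, which avoids truncated subtraction. *)
Lemma walk_mkseq (e k r : nat) (q p : nat -> bool) (X : nat -> nat) :
    (forall t, t < r -> X t.+1 + q t = X t + p t) ->
  reflect ((forall t, t < r -> q t + e <= X t /\ 0 < X t.+1 <= k) /\ X r = 1)
    (walk e k (X 0) (mkseq (fun t => (q t, p t)) r)).
Proof.
elim: r q p X => [|r IHr] q p X HX.
  by apply: (iffP eqP) => [-> //|[]].
have -> : mkseq (fun t => (q t, p t)) r.+1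
    = (q 0, p 0) :: mkseq (fun t => (q t.+1, p t.+1)) r.
  by rewrite /mkseq /= -[1]/(1 + 0) iotaDl -map_comp.
have HX0 := HX 0 isT.
apply: (iffP and3P) => [[qe Xk Wk]|[Ht Xr]].
  have X1 : X 0 - q 0 + p 0 = X 1 by lia.
  rewrite X1 in Xk Wk.
  have [|Ht Xr] := elimT (IHr (fun t => q t.+1) (fun t => p t.+1) (fun t => X t.+1) _) Wk.
    by move=> t tr; apply: HX.
  by split=> // -[|t] tr //; apply: Ht.
have [q0 X0] := Ht 0 isT.
have X1 : X 0 - q 0 + p 0 = X 1 by lia.
rewrite X1; split=> //.
apply/(IHr (fun t => q t.+1) (fun t => p t.+1) (fun t => X t.+1)).
  by move=> t tr; apply: HX.
by split=> // t tr; apply: Ht.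
Qed.

(** The position after [t] letters is [x] plus the second components minus the first components read
    so far; it stays positive and ends at 1. *)
Lemma walk_count (e k x : nat) (w : seq (bool * bool)) : 0 < x -> walk e k x w ->
  (forall t, count fst (take t w) < x + count snd (take t w)) /\
  x + count snd w = (count fst w).+1.
Proof.
elim: w x => [|[q p] w IHw] x x0 /=; first by move/eqP->.
move=> /and3P[qe /andP[x1 _] Hw].
have [Ht Hs] := IHw _ x1 Hw; split; last by lia.
by case=> [|t] /=; rewrite ?addn0 //; have := Ht t; lia.
Qed.

(** * From area sequences to words *)

Section AreaSequence.

Variables (r : nat) (a : {ffun 'I_r.+1 -> 'I_r.+1}).

Definition left (i : nat) : nat := i - a (inord i).

(** The last vertex is treated apart because [left r.+1] goes through a default value of [inord]. *)
Definition ends (j : nat) : bool := (j == r) || (left j != left j.+1).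

Definition starts (t : nat) : bool := [exists j : 'I_r.+1, left j == t].

Definition nest (t : nat) : nat :=
  \sum_(j < r.+1) (ends j && (left j <= t <= j)).

Definition word : r.-tuple (bool * bool) :=
  [tuple (ends t, starts t.+1) | t < r].

Lemma wordE : word = mkseq (fun t => (ends t, starts t.+1)) r :> seq _.
Proof.
rewrite /word /= /mkseq -val_enum_ord -map_comp; apply: eq_map => t //.
Qed.

Lemma edgeE (u v : 'I_r.+1) :
  edge a u v = ((u < v) && (left v <= u)) || ((v < u) && (left u <= v)).
Proof. by rewrite /edge /left !inord_val. Qed.

Lemma left_le i : left i <= i. Proof. exact: leq_subr. Qed.

Hypothesis aDP : a \in DP r.+1.

Lemma leftS i : i < r -> left i <= left i.+1.
Proof.
move=> ir; move: aDP; rewrite inE => /andP[_ /forallP/(_ (inord i.+1))/forallP/(_ (inord i))].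
by rewrite !inordK ?eqxx /=; rewrite /left; lia.
Qed.

Lemma left_mono i j : i <= j <= r -> left i <= left j.
Proof.
case/andP=> /subnKC<-; elim: (j - i) => [|d IHd] ijr; first by rewrite addn0.
by rewrite addnS; apply: leq_trans (leftS _); [apply: IHd|]; lia.
Qed.

Lemma ends_lt i j : ends i -> i < j <= r -> left i < left j.
Proof.
move=> + /andP[ij jr]; case/orP=> [/eqP|ne]; first by lia.
apply: (@leq_trans (left i.+1)); last by apply: left_mono; lia.
by rewrite ltn_neqAle ne leftS //; lia.
Qed.

(** For an edge {i, j}, the pair {i-1, j} is not an edge exactly when [left j] is [i], and then {i,
    j+1} is not an edge exactly when [left] increases after [j]. Isolated vertices fit the same
    description with [left j = j]. *)
Lemma peak_edgeE (i j : 'I_r.+1) : peak_edge a i j = ends j && (left j == i).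
Proof.
have [lj li] := (left_le j, left_le i).
have jr := ltn_ord j; have ir := ltn_ord i.
apply/idP/idP.
  case/orP=> [/andP[/eqP-> /forallP iso]|/and4P[ij e1 /forallP e2 /forallP e3]].
    have lj' : left j = j.
      apply/eqP; rewrite eqn_leq left_le /= leqNgt; apply/negP => ltj.
      have jj : j.-1 < r.+1 by lia.
      by have := iso (Ordinal jj); rewrite edgeE /=; lia.
    rewrite lj' eqxx andbT /ends; case: eqP => //= jr'.
    have jj : j.+1 < r.+1 by lia.
    by have := iso (Ordinal jj); rewrite edgeE /= lj'; lia.
  move: e1; rewrite edgeE => e1.
  have lji : left j = i.
    apply/eqP; rewrite eqn_leq; apply/andP; split; first by lia.
    rewrite leqNgt; apply/negP => lti.
    have jj : i.-1 < r.+1 by lia.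
    by have := e3 (Ordinal jj); rewrite edgeE /=; lia.
  rewrite lji eqxx andbT /ends; case: eqP => //= jr'.
  have jj : j.+1 < r.+1 by lia.
  by have := e2 (Ordinal jj); rewrite edgeE /= lji; lia.
case/andP=> ej /eqP lji; rewrite /peak_edge.
have H k : j < k <= r -> left j < left k by apply: ends_lt.
case: eqVneq => [ij|nij] /=.
  apply/orP; left; apply/forallP => k; rewrite edgeE.
  by have := H k; have := ltn_ord k; rewrite ij; move: lji; rewrite ij; lia.
have nij' : i <> j :> nat by move/val_inj => E; rewrite E eqxx in nij.
apply/and4P; split; first by lia.
- by rewrite edgeE; lia.
- apply/forallP => k; apply/implyP => /eqP kj; rewrite edgeE.
  by have := H k; have := ltn_ord k; lia.
- by apply/forallP => k; apply/implyP => /eqP kj; rewrite edgeE; lia.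
Qed.

(** A clique is determined by its right end, so the cliques containing [v] can be counted by right
    ends. *)
Lemma peak_nestingE (v : 'I_r.+1) : peak_nesting a v = nest v.
Proof.
pose cl (j : 'I_r.+1) : {set 'I_r.+1} := [set k : 'I_r.+1 | left j <= k <= j].
have -> : nest v = #|[set j : 'I_r.+1 | ends j && (left j <= v <= j)]|.
  by rewrite /nest -big_mkcond /= sum1_card cardsE.
have cl_inj : injective cl.
  move=> i j /setP E; apply/val_inj/eqP; rewrite eqn_leq.
  have := E i; have := E j; rewrite !inE !left_le !leqnn /= => Ei Ej.
  by rewrite /=; lia.
rewrite /peak_nesting -(card_imset _ cl_inj); congr #|pred_of_set _|.
apply/setP => K; rewrite !inE; apply/andP/imsetP.
  case=> /imsetP[[i j]]; rewrite !inE /= peak_edgeE => /andP[ej /eqP lj] -> vK.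
  exists j; last by rewrite /cl lj.
  by rewrite inE ej /=; move: vK; rewrite inE /= lj.
case=> j; rewrite inE => /andP[ej vj] ->; split; last by rewrite inE.
have lr : left j < r.+1 by apply: leq_ltn_trans (left_le j) _.
apply/imsetP; exists (Ordinal lr, j) => //.
by rewrite inE /= peak_edgeE ej /= eqxx.
Qed.

Lemma left_inj_ends i j : ends i -> ends j -> i <= r -> j <= r -> left i = left j -> i = j.
Proof.
move=> ei ej ir jr lij.
by have := @ends_lt i j ei; have := @ends_lt j i ej; lia.
Qed.

(** The last vertex with [left] value [t] is a right end. *)
Lemma starts_ends t : starts t -> exists j : 'I_r.+1, ends j && (left j == t).
Proof.
case/existsP=> i li.
case: (@arg_maxnP _ i (fun j : 'I_r.+1 => left j == t) val li) => j lj jmax.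
exists j; rewrite lj andbT /ends; case: eqP => //= jr.
apply/negP => /eqP E; have jj : j.+1 < r.+1 by have := ltn_ord j; lia.
have /= := jmax (Ordinal jj); rewrite -E => /(_ lj) /=; lia.
Qed.

(** [left] increases strictly after a right end, so at most one peak-clique starts at [t]. *)
Lemma sum_starts t : \sum_(j < r.+1) (ends j && (left j == t)) = starts t.
Proof.
rewrite -big_mkcond /= sum1_card; case: (boolP (starts t)) => st.
  have [j0 /andP[ej0 lj0]] := starts_ends st.
  rewrite -[RHS]/1 -(card1 j0); apply: eq_card => j.
  rewrite !inE; apply/andP/eqP => [[ej lj]|-> //].
  apply/val_inj/left_inj_ends => //; try exact: leq_ord.
  by rewrite (eqP lj) (eqP lj0).
apply: eq_card0 => j; apply/negP; rewrite inE => /andP[_ lj]; move/negP: st; apply.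
by apply/existsP; exists j.
Qed.

(** Passing from [t] to [t.+1] loses the clique ending at [t] and gains the one starting at [t.+1];
    the equation holds clique by clique. *)
Lemma nestS t : t < r -> nest t.+1 + ends t = nest t + starts t.+1.
Proof.
move=> tr; rewrite -sum_starts.
have -> : (ends t : nat) = \sum_(j < r.+1) (ends j && (j == t :> nat)).
  have tr' : t < r.+1 by lia.
  rewrite (bigD1 (Ordinal tr')) //= eqxx andbT big1 ?addn0 // => j.
  by rewrite -val_eqE /= => /negbTE->; rewrite andbF.
rewrite -!big_split /=; apply: eq_bigr => j _.
by have := left_le j; case: (ends j) => //=; lia.
Qed.

Lemma starts0 : starts 0.
Proof. by apply/existsP; exists ord0; rewrite /left. Qed.

Lemma nest0 : nest 0 = 1.
Proof.
rewrite -[RHS]/(nat_of_bool true) -starts0 -sum_starts; apply: eq_bigr => j _.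
by rewrite leqn0 andbT.
Qed.

Lemma nest_r : nest r = 1.
Proof.
rewrite /nest big_ord_recr /= leqnn left_le /ends eqxx /= big1 // => j _.
by rewrite [r <= j]leqNgt ltn_ord !andbF.
Qed.

Lemma pnest_leP k : reflect (forall t, t <= r -> nest t <= k) (pnest a <= k).
Proof.
apply: (iffP (bigmax_leqP _ _ _)) => [H t tr|H v _].
  have tr' : t < r.+1 by lia.
  by have := H (Ordinal tr') isT; rewrite peak_nestingE.
by rewrite peak_nestingE H // -ltnS.
Qed.

Lemma nest_gt0 t : t <= r -> 0 < nest t.
Proof.
move=> tr; have tr' : t < r.+1 by lia.
have : starts (left t) by apply/existsP; exists (Ordinal tr').
move/starts_ends=> [j /andP[ej /eqP lj]].
rewrite /nest (bigD1 j) //= ej lj left_le /=.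
suff -> : t <= j by [].
by rewrite leqNgt; apply/negP => jt; have := @ends_lt j t ej; lia.
Qed.

(** Apart from the clique ending at [t], the strict inequality asks for a clique through [t] that
    ends later, hence for an edge from [t] to [t.+1]. This is the condition that the walk avoids 0
    between its two half steps. *)
Lemma ends_lt_nestE t : t < r -> (ends t < nest t) = (left t.+1 <= t).
Proof.
move=> tr; have tr' : t < r.+1 by lia.
rewrite /nest (bigD1 (Ordinal tr')) //= left_le leqnn /= andbT -{1}[ends t : nat]addn0.
rewrite ltn_add2l; apply/idP/idP.
  rewrite lt0n sum_nat_eq0 negb_forall => /existsP[j].
  rewrite -val_eqE /= => H.
  have := @left_mono t.+1 j; have := ltn_ord j; move: H; lia.
move=> lt.
have tr1 : t.+1 < r.+1 by lia.
have : starts (left t.+1) by apply/existsP; exists (Ordinal tr1).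
move/starts_ends=> [j /andP[ej /eqP lj]].
have tj : t < j.
  rewrite ltnNge; apply/negP => jt; have := @ends_lt j t.+1 ej; lia.
have jt : j != Ordinal tr' by rewrite -val_eqE /=; lia.
by rewrite (bigD1 j) //= ej lj lt (ltnW tj).
Qed.

Lemma connectedP :
  reflect (forall t, t < r -> left t.+1 <= t) (graph_connected a).
Proof.
apply: (iffP forallP) => [H t tr|H u].
  rewrite leqNgt; apply/negP => lt.
  have /forallP/(_ ord_max) := H ord0; apply/negP.
  (* If [t] and [t.+1] are not adjacent, monotonicity of [left] lets no edge cross between them. *)
  have cl : closed (edge a) [pred v : 'I_r.+1 | v <= t].
    move=> u v; rewrite edgeE !inE.
    have := @left_mono t.+1 v; have := @left_mono t.+1 u.
    by have := ltn_ord u; have := ltn_ord v; lia.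
  apply/negP => /(closed_connect cl); rewrite !inE /=; lia.
have sym : connect_sym (edge a).
  by apply: sym_connect_sym => x y; rewrite /edge orbC.
have H0 (v : 'I_r.+1) : connect (edge a) ord0 v.
  case: v => m; elim: m => [|m IHm] mr.
    by rewrite (_ : Ordinal mr = ord0) ?connect0 //; apply/val_inj.
  have mr' : m < r.+1 by lia.
  apply: connect_trans (IHm mr') (connect1 _).
  by rewrite edgeE /= ltnSn H.
by apply/forallP => v; rewrite (connect_trans _ (H0 v)) // sym.
Qed.

(** The factor [0 < k] concerns the empty word: [walk] tests positions only after a step, so for
    [r = 0] it accepts [k = 0], whereas a single vertex has peak-nesting 1. *)
Lemma walk_word (b : bool) (k : nat) :
  (0 < k) && walk b k 1 word = (pnest a <= k) && (b ==> graph_connected a).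
Proof.
rewrite wordE -nest0; apply/andP/andP.
  case=> k0 /(walk_mkseq _ _ nestS)[Ht _].
  split.
    apply/pnest_leP => -[|t] tr; first exact: k0.
    by have [_ /andP[]] := Ht _ tr.
  apply/implyP => Hb; apply/connectedP => t tr; rewrite -ends_lt_nestE //.
  by have [] := Ht _ tr; rewrite Hb addn1.
case=> /pnest_leP Hk /implyP Hb; split; first exact: Hk.
apply/(walk_mkseq _ _ nestS).
split=> [t tr|]; last exact: nest_r.
split; last by rewrite nest_gt0 ?Hk.
case: b Hb => [/(_ isT)/connectedP Hb|_].
  by rewrite addn1 ends_lt_nestE // Hb.
by rewrite addn0; have := @nest_gt0 t; case: (ends t); lia.
Qed.

End AreaSequence.

(** [left] is recovered from left to right: it keeps its value unless a clique ends at [t], and then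
    it jumps to the next left end. *)
Lemma word_inj r : {in DP r.+1 &, injective (@word r)}.
Proof.
suff H a b : a \in DP r.+1 -> b \in DP r.+1 -> word a = word b ->
    forall t, t <= r -> left a t <= left b t.
  move=> a b aDP bDP ab; apply/ffunP => i; apply/val_inj => /=.
  have ir := leq_ord i.
  have := H _ _ aDP bDP ab _ ir; have := H _ _ bDP aDP (esym ab) _ ir.
  move: aDP bDP; rewrite !inE /left !inord_val.
  by move=> /andP[/forallP/(_ i)+ _] /andP[/forallP/(_ i)+ _]; lia.
move=> aDP bDP E.
have Et t : t < r -> ends a t = ends b t /\ starts a t.+1 = starts b t.+1.
  move=> tr; have := congr1 (fun w : r.-tuple _ => nth (false, false) w t) E.
  by rewrite !wordE !nth_mkseq // => -[].
have Es t : t <= r -> starts a t = starts b t.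
  by case: t => [|t] tr; [rewrite !starts0|have [] := Et t tr].
suff ab t : t <= r -> left a t = left b t by move=> t /ab->.
elim: t => [|t IHt] tr; first by rewrite /left.
have {IHt}IH := IHt (ltnW tr).
have [eab _] := Et t tr; have tr1 : t.+1 < r.+1 by [].
case: (boolP (ends a t)) => ea; last first.
  have eb : ~~ ends b t by rewrite -eab.
  move: ea eb; rewrite /ends; have -> /= : (t == r) = false by lia.
  by rewrite !negbK => /eqP<- /eqP<-.
have eb : ends b t by rewrite -eab.
apply/eqP; rewrite eqn_leq; apply/andP; split.
  (* The value [left b t.+1] is also taken by [left a], at a vertex beyond [t] because it exceeds
     [left b t = left a t]; monotonicity gives one inequality, and exchanging [a] and [b] the
     other. *)
  have : starts b (left b t.+1) by apply/existsP; exists (Ordinal tr1).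
  rewrite -Es; last by have := left_le b t.+1; lia.
  case/existsP=> j /eqP lj; rewrite -lj; apply: left_mono => //.
  rewrite leq_ord andbT ltnNge; apply/negP => jt.
  have := @left_mono _ _ aDP j t; have := @ends_lt _ _ bDP t t.+1 eb; lia.
have : starts a (left a t.+1) by apply/existsP; exists (Ordinal tr1).
rewrite Es; last by have := left_le a t.+1; lia.
case/existsP=> j /eqP lj; rewrite -lj; apply: left_mono => //.
rewrite leq_ord andbT ltnNge; apply/negP => jt.
have := @left_mono _ _ bDP j t; have := @ends_lt _ _ aDP t t.+1 ea; lia.
Qed.

Lemma count_takeS (T : Type) (x0 : T) (P : pred T) (w : seq T) (t : nat) : t < size w ->
  count P (take t.+1 w) = count P (take t w) + P (nth x0 w t).
Proof. by move=> tw; rewrite (take_nth x0) // -cats1 count_cat /= addn0. Qed.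

Lemma leq_count_take (T : Type) (P : pred T) (w : seq T) (s t : nat) : s <= t ->
  count P (take s w) <= count P (take t w).
Proof.
by move=> st; rewrite -[X in _ <= count _ X](cat_take_drop s) take_takel // count_cat leq_addr.
Qed.

(** The inverse pairs the m-th left end with the m-th right end of the word; positivity of the walk
    puts them in the right order. *)
Lemma word_surj (e k r : nat) (w : r.-tuple (bool * bool)) :
  walk e k 1 w -> exists2 a, a \in DP r.+1 & word a = w.
Proof.
case/walk_count=> // Hlt Heq.
(* [c t] counts the right ends before [t] and [P v] the left ends up to [v]; the extra 1 is the left
   end at vertex 0, which the word omits. *)
pose c t := count fst (take t w); pose P v := (count snd (take v w)).+1.
have szw := size_tuple w.
have cS t : t < r -> c t.+1 = c t + (nth (false, false) w t).1.
  by move=> tr; rewrite /c (count_takeS (false, false)) // szw.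
have PS t : t < r -> P t.+1 = P t + (nth (false, false) w t).2.
  by move=> tr; rewrite /P (count_takeS (false, false)) ?szw // addSn.
have cP t : c t < P t by have := Hlt t; rewrite add1n.
have cPr : P r = (c r).+1 by rewrite /P /c !take_oversize ?szw // -Heq add1n.
(* [f t] is the left end number [c t + 1], that of the first clique ending at or after [t]. *)
pose f t := find (fun v => c t < P v) (iota 0 r.+1).
have f_has t : t <= r -> has (fun v => c t < P v) (iota 0 r.+1).
  by move=> tr; apply/hasP; exists t => //; rewrite mem_iota.
have f_sat t : t <= r -> c t < P (f t).
  move=> tr; have := nth_find 0 (f_has t tr).
  by rewrite nth_iota ?add0n //; have := f_has t tr; rewrite has_find size_iota.
have f_min t v : t <= r -> v <= r -> c t < P v -> f t <= v.
  move=> tr vr ctv; rewrite leqNgt; apply/negP => fv.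
  by have := before_find 0 fv; rewrite nth_iota ?add0n ?ctv.
have f_le t : t <= r -> f t <= t by move=> tr; apply: f_min.
have f_P t : t <= r -> P (f t) = (c t).+1.
  move=> tr; have := f_sat t tr; have := f_le t tr.
  case E: (f t) => [|v] vt; first by rewrite /P take0 /=; lia.
  have := f_min t v tr; rewrite E PS; last by lia.
  by case: (nth _ _ _).2; lia.
have fS t : t < r -> f t <= f t.+1.
  move=> tr; apply: f_min; [lia| |].
    by apply: leq_trans (f_le t.+1 tr) _.
  by apply: leq_ltn_trans (f_sat t.+1 tr); rewrite cS ?leq_addr.
have fends t : t < r -> (f t != f t.+1) = (nth (false, false) w t).1.
  move=> tr; have := f_P t (ltnW tr); have := f_P t.+1 tr; rewrite cS //.
  case E: (nth _ _ _).1 => H1 H2.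
    by apply/eqP => E'; move: H1 H2; rewrite E'; lia.
  apply/eqP/eqP; rewrite eqn_leq fS //=; apply: f_min => //.
    by have := f_le t; lia.
  by rewrite cS // E addn0 f_sat // ltnW.
have fstarts v : v < r -> [exists j : 'I_r.+1, f j == v.+1] = (nth (false, false) w v).2.
  move=> vr; apply/existsP/idP.
    case=> j /eqP fj; have jr := leq_ord j; have := f_sat j jr; rewrite fj PS //.
    have := f_min j v jr (ltnW vr); rewrite fj.
    by case: (nth _ _ _).2; lia.
  move=> pv; have PvS := PS v vr; rewrite pv addn1 in PvS.
  have Pmono u u' : u <= u' -> P u <= P u' by move=> uu; rewrite ltnS leq_count_take.
  (* Discrete intermediate value: [c] rises from 0 by steps of at most 1, and [c r] is at least
     [P v]. *)
  have [t tr ct] : exists2 t, t <= r & c t = P v.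
    have Pv : 0 < P v by [].
    have Pvc : P v <= c r by have := Pmono _ _ vr; lia.
    have c0 : c 0 = 0 by rewrite /c take0.
    suff H s : s <= r -> P v <= c s -> exists2 t, t <= r & c t = P v by apply: H Pvc.
    elim: s => [|s IHs] sr Hs; first by lia.
    case: (leqP (P v) (c s)) => Hs'; first by apply: IHs => //; lia.
    by exists s.+1 => //; rewrite cS // in Hs *; lia.
  have tr' : t < r.+1 by [].
  exists (Ordinal tr') => /=; rewrite eqn_leq; apply/andP; split.
    by apply: f_min => //; lia.
  rewrite ltnNge; apply/negP => ftv; have := f_sat t tr.
  have := Pmono _ _ ftv.
  lia.
pose a := [ffun i : 'I_r.+1 => inord (i - f i) : 'I_r.+1].
have aE (i : 'I_r.+1) : a i = i - f i :> nat.
  by rewrite ffunE inordK // ltnS; have := leq_ord i; lia.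
have la t : t <= r -> left a t = f t.
  by move=> tr; rewrite /left aE inordK //; have := f_le t tr; lia.
exists a.
  rewrite inE; apply/andP; split; apply/forallP => i; first by rewrite aE; lia.
  apply/forallP => j; apply/implyP => /eqP ij; rewrite !aE ij.
  by have := fS j; have := leq_ord i; lia.
apply/val_inj; apply: etrans (wordE a) _.
apply: (@eq_from_nth _ (false, false)); rewrite size_mkseq ?szw // => t tr.
rewrite nth_mkseq // [RHS]surjective_pairing -fends // -fstarts //.
congr pair.
  by rewrite /ends !la ?(ltnW tr) //; have -> : (t == r) = false by lia.
by apply: eq_existsb => j; rewrite la // leq_ord.
Qed.

Lemma card_DP_walk (b : bool) (k r : nat) :
  #|[set a in DP r.+1 | (pnest a <= k) && (b ==> graph_connected a)]| =
  #|[set w : r.-tuple (bool * bool) | (0 < k) && walk b k 1 w]|.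
Proof.
rewrite -(@card_in_imset _ _ (@word r)); last first.
  by move=> x y /setIdP[xD _] /setIdP[yD _]; apply: word_inj.
congr #|pred_of_set _|; apply/setP => w; rewrite inE; apply/imsetP/idP.
  by case=> a /setIdP[aDP H] ->; rewrite walk_word // H.
move=> H; have [k0 /word_surj[a aDP aw]] := andP H.
by exists a => //; rewrite -aw walk_word // in H; apply/setIdP.
Qed.

Local Open Scope ring_scope.

(** * Recursion for the number of walks *)

Lemma sum_tupleS (T : finType) (s : nat) (F : s.+1.-tuple T -> nat) :
  (\sum_w F w = \sum_(x : T) \sum_(w : s.-tuple T) F [tuple of x :: w])%N.
Proof.
rewrite pair_big /= (reindex (fun p : T * s.-tuple T => [tuple of p.1 :: p.2])) //=.
exists (fun w => (thead w, [tuple of behead w])) => [[x w] _|w _] /=.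
  by congr pair; apply/val_inj.
by rewrite [RHS]tuple_eta; apply/val_inj.
Qed.

Definition walks (e k r x : nat) : nat := #|[set w : r.-tuple (bool * bool) | walk e k x w]|.

Lemma walks0 e k x : walks e k 0 x = (x == 1)%N.
Proof.
rewrite /walks; case: (eqVneq x 1%N) => [->|nx]; last first.
  by apply: eq_card0 => w; rewrite inE tuple0 /= (negbTE nx).
rewrite -[RHS](cards1 ([tuple] : 0.-tuple (bool * bool))); congr #|pred_of_set _|.
by apply/setP => w; rewrite !inE [w]tuple0 /= eqxx.
Qed.

Lemma walksS e k r x : (walks e k r.+1 x =
  \sum_(q : bool) \sum_(p : bool)
    ((q + e <= x) && (0 < x - q + p <= k)) * walks e k r (x - q + p))%N.
Proof.
have E s y : walks e k s y = (\sum_(w : s.-tuple (bool * bool)) walk e k y w)%N.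
  by rewrite -big_mkcond /= sum1_card /walks cardsE.
rewrite E sum_tupleS [RHS]pair_big /=; apply: eq_bigr => -[q p] _ /=.
by rewrite E big_distrr /=; apply: eq_bigr => w _; rewrite mulnb -!andbA.
Qed.

(** * The reflection principle *)

Section Reflection.

(** The sum over j of binomial(s, j) g(z + j): [g] is summed over the ends of [s] half steps, each 0
    or +1. From [x - r], a number [2 * r] of them amounts to half steps of -1/2 or +1/2 from [x]. *)
Fixpoint pascal (g : int -> rat) (s : nat) (z : int) : rat :=
  if s is s'.+1 then pascal g s' z + pascal g s' (z + 1) else g z.

(** Reflection exchanges the two kinds of half steps; the shift by [s] accounts for replacing j by s
    - j. *)
Lemma pascal_anti (g : int -> rat) (c : int) (s : nat) (z : int) :
  (forall y, g (c - y) = - g y) -> pascal g s (c - s%:Z - z) = - pascal g s z.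
Proof.
move=> gc; elim: s z => [|s IHs] z /=; first by rewrite subr0.
rewrite opprD -!IHs addrC; congr (pascal _ _ _ + pascal _ _ _); lia.
Qed.

Lemma pascal_per (g : int -> rat) (M : int) (s : nat) (z : int) :
  (forall y, g (y + M) = g y) -> pascal g s (z + M) = pascal g s z.
Proof.
by move=> gM; elim: s z => [|s IHs] z //=; rewrite addrAC !IHs.
Qed.

Lemma pascalD (g h : int -> rat) (s : nat) (z : int) :
  pascal (g \+ h) s z = pascal g s z + pascal h s z.
Proof. by elim: s z => [|s IHs] z //=; rewrite !IHs addrACA. Qed.

Lemma pascalB (g h : int -> rat) (s : nat) (z : int) :
  pascal (g \- h) s z = pascal g s z - pascal h s z.
Proof. by elim: s z => [|s IHs] z //=; rewrite !IHs opprD addrACA. Qed.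

Lemma eq_pascal (g h : int -> rat) (s : nat) (z : int) :
  (forall y, z <= y <= z + s%:Z -> g y = h y) -> pascal g s z = pascal h s z.
Proof.
elim: s z => [|s IHs] z gh /=; first by apply: gh; lia.
by rewrite !IHs // => y zy; apply: gh; lia.
Qed.

(** Also true for negative [z]: at -1 the factor vanishes, and below it both sides are 0 by
    convention. *)
Lemma inv_factS (z : int) : inv_fact z = (z + 1)%:~R * inv_fact (z + 1).
Proof.
case: z => [m|[|m]].
- have -> : Posz m + 1 = m.+1 by lia.
  rewrite -[inv_fact m.+1]/(((m.+1)`!)%:R^-1) -[LHS]/((m`!)%:R^-1) factS natrM.
  by rewrite -pmulrn invfM mulrA mulfV ?mul1r // pnatr_eq0.
- by have -> : Negz 0 + 1 = 0 by []; rewrite mul0r.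
have -> : Negz m.+1 + 1 = Negz m by lia.
by rewrite mulr0.
Qed.

Lemma inv_factB1 (z : int) : inv_fact (z - 1) = z%:~R * inv_fact z.
Proof. by rewrite inv_factS subrK. Qed.

(** The binomial coefficient of [s] and [m] for every integer [m], zero outside [0, s], so that
    Pascal's rule needs no cases. *)
Definition binz (s : nat) (m : int) : rat :=
  (s`!)%:R * inv_fact m * inv_fact (s%:Z - m).

Lemma binzS s m : binz s.+1 m = binz s m + binz s (m - 1).
Proof.
rewrite /binz; have -> : s%:Z - m = s.+1%:Z - m - 1 by lia.
have -> : s%:Z - (m - 1) = s.+1%:Z - m by lia.
rewrite !inv_factB1 factS natrM !rmorphB /= -!pmulrn -addn1 !natrD; ring.
Qed.

Lemma binz0 m : binz 0 m = (m == 0)%:R.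
Proof.
rewrite /binz sub0r; case: m => [[|m]|m] /=; rewrite ?mul1r ?mul0r ?divr1 ?mulr0 ?invr1 //.
Qed.

(** Going from [z] to [c] takes [c - z] half steps +1 among [s]. *)
Lemma pascal_delta (c : int) (s : nat) (z : int) :
  pascal (fun y => (y == c)%:R) s z = binz s (c - z).
Proof.
elim: s z => [|s IHs] z /=; first by rewrite binz0 subr_eq0 eq_sym.
by rewrite !IHs binzS opprD addrA.
Qed.

Variables (b : bool) (k : nat).

(** The reflections in the barriers b/2 and k + 1 compose to a translation by [M], twice their
    distance. Connectedness moves the lower barrier from 0 to 1/2, which kills the half step down
    from 1. *)
Let M : int := 2 * k%:Z + 2 - b%:Z.

(* The reflections in the two absorbing ends carry the target of a walk, 1, to
   the points congruent to 1 (with sign +) and to b - 1 (with sign -) modulo M. *)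
Definition images (z : int) : rat := (M %| z - 1)%Z%:R - (M %| z + 1 - b%:Z)%Z%:R.

Lemma images_anti z : images (b%:Z - z) = - images z.
Proof.
rewrite /images opprB.
have -> : b%:Z - z - 1 = - (z + 1 - b%:Z) by lia.
have -> : b%:Z - z + 1 - b%:Z = - (z - 1) by lia.
by rewrite !rpredN.
Qed.

Lemma images_per z : images (z + M) = images z.
Proof.
rewrite /images.
have -> : z + M - 1 = z - 1 + M by lia.
have -> : z + M + 1 - b%:Z = z + 1 - b%:Z + M by lia.
by rewrite !(rpredDr _ (dvdzz M)).
Qed.

Lemma images_small (x : nat) : (0 < x <= k)%N -> images x%:Z = (x == 1)%N%:R.
Proof.
move=> xk; rewrite /images.
have H d : 0 < d < M -> (M %| d)%Z = false.
  case: d => // d dM; apply/negP; rewrite dvdzE /= => /dvdn_leq.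
  by rewrite /M in dM *; lia.
rewrite [(M %| _ + 1 - _)%Z]H ?subr0; last by rewrite /M; lia.
case: eqVneq => [->|x1]; first by rewrite subrr dvdz0.
by rewrite H // /M; lia.
Qed.

(** The right-hand side satisfies the recursion of the free walk, and antisymmetry with periodicity
    gives it the boundary values that turn this into the recursion of the confined walk. *)
Lemma walks_pascal (r x : nat) : (0 < x <= k)%N ->
  (walks b k r x)%:R = pascal images (2 * r) (x%:Z - r%:Z).
Proof.
pose V r (x : int) := pascal images (2 * r) (x - r%:Z).
rewrite -[RHS]/(V r x%:Z); elim: r x => [|r IHr] x xk.
  by rewrite walks0 /V subr0 /= images_small.
have VS y : V r.+1 y = V r (y - 1) + 2 * V r y + V r (y + 1).
  rewrite /V mulnS /=.
  have -> : y - r.+1%:Z + 1 = y - r%:Z by lia.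
  have -> : y - r.+1%:Z = y - 1 - r%:Z by lia.
  have -> : y - r%:Z + 1 = y + 1 - r%:Z by lia.
  ring.
have Vanti y : V r (b%:Z - y) = - V r y.
  rewrite /V -(pascal_anti _ _ images_anti); congr pascal; lia.
have Vper y : V r (y + M) = V r y.
  rewrite /V; have -> : y + M - r%:Z = y - r%:Z + M by lia.
  exact/pascal_per/images_per.
(* [k + 1] is fixed by the reflection followed by the shift by [M]. *)
have Vtop : V r (k%:Z + 1) = 0.
  have := Vanti (k%:Z + 1); rewrite -Vper.
  have -> : b%:Z - (k%:Z + 1) + M = k%:Z + 1 by rewrite /M; lia.
  by lra.
rewrite walksS !big_bool /= !natrD !natrM VS.
have Wx : (walks b k r x)%:R = V r x by exact: IHr.
have WS : ((x + 1 <= k)%N%:R * (walks b k r (x + 1))%:R = V r (x%:Z + 1) :> rat).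
  case: (leqP (x + 1)%N k) => xk'; last first.
    by rewrite mul0r -Vtop; congr (V _ (_ + 1)); lia.
  by rewrite mul1r IHr; [congr V|]; lia.
rewrite subn0 !addn0 Wx (subnK (proj1 (andP xk))) Wx.
have -> : [&& (0 + b <= x)%N, (0 < x)%N & (x <= k)%N] = true by lia.
have -> : [&& (0 + b <= x)%N, (0 < x + 1)%N & (x + 1 <= k)%N] = (x + 1 <= k)%N by lia.
rewrite WS mul1r.
(* At 1 the free recursion involves [V r 0]. It is 0 when [b] is false; when [b] is true it is
   [- V r 1] and cancels the stay with [q] and [p] both true, which is then forbidden. *)
have [x1|x1] := eqVneq x 1%N.
  have -> : [&& (1 + b <= x)%N, (0 < x - 1)%N & (x - 1 <= k)%N] = false by lia.
  have -> : [&& (1 + b <= x)%N, (0 < x)%N & (x <= k)%N] = ~~ b by case: (b); lia.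
  rewrite x1 -[1%N%:Z]/(1 : int) subrr; have := Vanti b%:Z; rewrite subrr.
  by case: (b) => /=; rewrite -?[true%:Z]/(1 : int) -?[false%:Z]/(0 : int); lra.
have -> : [&& (1 + b <= x)%N, (0 < x - 1)%N & (x - 1 <= k)%N] = true by lia.
have -> : [&& (1 + b <= x)%N, (0 < x)%N & (x <= k)%N] = true by lia.
rewrite IHr; last by lia.
have -> : (x - 1)%N%:Z = x%:Z - 1 by lia.
rewrite !mul1r; lra.
Qed.

End Reflection.

(** * First reflections for large [k] *)

Section LargeModulus.

Variables (b : bool) (r : nat).

(** binomial(2r, r + d), the number of sequences of [2 * r] half steps of -1/2 or +1/2 with total
    displacement [d]. *)
Definition beta (d : int) : rat := binz (2 * r) (r%:Z + d).

Lemma betaE d : beta d = (2 * r)`!%:R * inv_fact (r%:Z + d) * inv_fact (r%:Z - d).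
Proof. by rewrite /beta /binz; congr (_ * inv_fact _); lia. Qed.

Lemma betaN d : beta (- d) = beta d.
Proof. by rewrite !betaE opprK mulrAC. Qed.

Lemma dvdz_small (M d : int) : 0 < M -> - (2 * M) < d < 2 * M ->
  (M %| d)%Z%:R = (d == 0)%:R + (d == M)%:R + (d == - M)%:R :> rat.
Proof.
move=> M0 dM; case: dvdzP => [[q E]|nd]; last first.
  have [d0|_] := eqVneq d 0; first by case: nd; exists 0; lia.
  have [d1|_] := eqVneq d M; first by case: nd; exists 1; lia.
  have [d1|_] := eqVneq d (- M); first by case: nd; exists (-1); lia.
  by rewrite /= !addr0.
have : [|| q == 0, q == 1 | q == -1].
  have : q < 2 by nia.
  have : -2 < q by nia.
  lia.
case/or3P=> /eqP Eq; rewrite E Eq ?mul0r ?mul1r ?mulN1r ?eqxx.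
- have -> : (0 == M) = false by lia.
  by have -> : (0 == - M) = false by lia; rewrite /= !addr0.
- have -> : (M == 0) = false by lia.
  by have -> : (M == - M) = false by lia; rewrite /= addr0 add0r.
have -> : (- M == 0) = false by lia.
by have -> : (- M == M) = false by lia; rewrite /= !add0r.
Qed.

(** [2 * r] half steps from 1 reach only [1 - r, 1 + r]; the bound on [r] leaves there at most the
    images shifted by 0, [M] and [- M]. *)
Lemma pascal_images (k : nat) (M : int) : M = 2 * k%:Z + 2 - b%:Z ->
    (r%:Z + 2 - b%:Z < 2 * M) ->
  pascal (images b k) (2 * r) (1 - r%:Z) =
  beta 0 + 2 * beta M
  - (beta (2 - b%:Z) + beta (M - (2 - b%:Z)) + beta (M + (2 - b%:Z))).
Proof.
move=> EM rM; have M0 : 0 < M by lia.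
pose D c (y : int) : rat := (y == c)%:R.
rewrite (@eq_pascal _ ((D 1 \+ D (1 + M) \+ D (1 - M))
    \- (D (b%:Z - 1) \+ D (b%:Z - 1 + M) \+ D (b%:Z - 1 - M)))); last first.
  move=> y yr; rewrite /images -EM /D /= !dvdz_small //; [|lia|lia].
  congr (_%:R + _%:R + _%:R - (_%:R + _%:R + _%:R)); lia.
have pascal_D c : pascal (D c) (2 * r) (1 - r%:Z) = beta (c - 1).
  by rewrite pascal_delta /beta; congr binz; lia.
rewrite pascalB !pascalD !pascal_D.
have -> : 1 - 1 = 0 :> int by [].
have -> : 1 + M - 1 = M by lia.
have -> : 1 - M - 1 = - M by lia.
have -> : b%:Z - 1 - 1 = - (2 - b%:Z) by lia.
have -> : b%:Z - 1 + M - 1 = M - (2 - b%:Z) by lia.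
have -> : b%:Z - 1 - M - 1 = - (M + (2 - b%:Z)) by lia.
rewrite !betaN; ring.
Qed.

End LargeModulus.

(** * Coefficients as differences of walk counts *)

Lemma coef_sum_exp (T : finType) (A : {set T}) (P : pred T) (p : T -> nat) (i : nat) :
  (\sum_(a in A | P a) 'X^(p a) : {poly int})`_i = #|[set a in A | (p a == i) && P a]|%:Z.
Proof.
rewrite coef_sum -sum1_card -[RHS]natz natr_sum.
rewrite (eq_bigl (fun a => (a \in A) && P a && (p a == i))); last first.
  by move=> a; rewrite inE -andbA; congr andb; rewrite andbC.
rewrite [RHS]big_mkcondr /=; apply: eq_bigr => a _.
by rewrite coefXn eq_sym; case: eqP.
Qed.

(** The value 0 at [k = 0] is imposed, since [walks b 0 0 1] is 1 while every peak-nesting maximum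
    is positive. *)
Definition nwalks (b : bool) (r k : nat) : nat := if (0 < k)%N then walks b k r 1 else 0%N.

Lemma card_DP_nwalks b r k :
  #|[set a in DP r.+1 | (pnest a <= k)%N && (b ==> graph_connected a)]| = nwalks b r k.
Proof.
rewrite card_DP_walk /nwalks; case: ifP => //= _.
by apply/eqP; rewrite cards_eq0; apply/eqP/setP => w; rewrite !inE.
Qed.

Lemma coef_nwalks b r i :
  (\sum_(a in DP r.+1 | b ==> graph_connected a) 'X^(pnest a) : {poly int})`_i.+1
  = (nwalks b r i.+1)%:Z - (nwalks b r i)%:Z.
Proof.
rewrite coef_sum_exp -!card_DP_nwalks; apply/eqP; rewrite eq_sym subr_eq; apply/eqP.
rewrite -PoszD; congr Posz; rewrite -cardsUI [X in (_ + X)%N]eq_card0 ?addn0.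
  apply: eq_card => a; rewrite !inE -!andb_orr; congr andb.
  by rewrite -andb_orl; congr andb; lia.
by move=> a; rewrite !inE; apply/negP => /andP[/and3P[_ /eqP-> _] /and3P[_ ? _]]; lia.
Qed.

Lemma coef_Pnest r i :
  (Pnest r.+1)`_i.+1 = (nwalks false r i.+1)%:Z - (nwalks false r i)%:Z.
Proof.
rewrite -coef_nwalks; congr (nth 0 _.(polyseq) _); apply: eq_bigl => a.
by rewrite andbT.
Qed.

Lemma coef_PnestC r i :
  (PnestC r.+1)`_i.+1 = (nwalks true r i.+1)%:Z - (nwalks true r i)%:Z.
Proof. by rewrite -coef_nwalks. Qed.

(** For [k = 0] the positive and negative images coincide, so the reflection formula still gives the
    right value 0; this covers the coefficient of index 1. *)
Lemma images0 b z : images b 0 z = 0.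
Proof.
rewrite /images; case: b => /=; first by rewrite !dvd1z subrr.
rewrite mulr0 add0r !subr0.
have -> : z + 1 = z - 1 + 2 by lia.
by rewrite (rpredDr _ (dvdzz 2)) subrr.
Qed.

Lemma nwalks_pascal b r k :
  (nwalks b r k)%:R = pascal (images b k) (2 * r) (1 - r%:Z).
Proof.
rewrite /nwalks; case: posnP => [->|k0] /=; last by rewrite walks_pascal.
elim: (2 * r)%N (1 - r%:Z) => [|s IHs] z /=; first by rewrite images0.
by rewrite -!IHs addr0.
Qed.

(** The cases [k = i] and [k = i - 1] are subtracted. Their moduli are 2i + 2 and 2i, and the
    smaller one requires r + 2 < 4i. The result is minus a third difference with step 2. *)
Lemma coef_Pnest_beta r i : (r.+3 <= 4 * i)%N -> ((Pnest r.+1)`_i)%:~R =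
  beta r (2 * i%:Z - 2) - 3 * beta r (2 * i%:Z) + 3 * beta r (2 * i%:Z + 2)
  - beta r (2 * i%:Z + 4).
Proof.
case: i => [|i] ri; first by lia.
rewrite coef_Pnest rmorphB /= -!pmulrn !nwalks_pascal.
rewrite !(pascal_images erefl) ?subr0; [|lia|lia].
have -> : 2 * i.+1%:Z - 2 = 2 * i%:Z by lia.
have -> : 2 * i.+1%:Z + 4 = 2 * i.+1%:Z + 2 + 2 by lia.
have -> : 2 * i%:Z + 2 = 2 * i.+1%:Z by lia.
rewrite addrK; have -> : 2 * i.+1%:Z - 2 = 2 * i%:Z by lia.
ring.
Qed.

(** Here the moduli are 2i + 1 and 2i - 1, the smaller one requires r + 1 < 4i - 2, and the terms at
    2i cancel. *)
Lemma coef_PnestC_beta r i : (r.+4 <= 4 * i)%N -> ((PnestC r.+1)`_i)%:~R =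
  beta r (2 * i%:Z - 2) - 2 * beta r (2 * i%:Z - 1) + 2 * beta r (2 * i%:Z + 1)
  - beta r (2 * i%:Z + 2).
Proof.
case: i => [|i] ri; first by lia.
rewrite coef_PnestC rmorphB /= -!pmulrn !nwalks_pascal.
rewrite !(pascal_images erefl); [|lia|lia].
have E (j : nat) : 2 * j%:Z + 2 - true%:Z = 2 * j%:Z + 1 by rewrite /=; lia.
have -> : 2 - true%:Z = 1 by [].
rewrite !E !addrK.
have -> : 2 * i.+1%:Z + 2 = 2 * i.+1%:Z + 1 + 1 by lia.
have -> : 2 * i%:Z + 1 = 2 * i.+1%:Z - 1 by lia.
have -> : 2 * i%:Z = 2 * i.+1%:Z - 2 by lia.
rewrite subrK; ring.
Qed.

(** * Closed formulas *)

Lemma inv_factB (z : int) (m : nat) :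
  inv_fact (z - m%:Z) = (\prod_(j < m) (z%:~R - j%:R)) * inv_fact z.
Proof.
elim: m => [|m IHm]; first by rewrite subr0 big_ord0 mul1r.
have -> : z - m.+1%:Z = z - m%:Z - 1 by lia.
rewrite inv_factB1 IHm big_ord_recr /= rmorphB /= -pmulrn; ring.
Qed.

Lemma coef_Pnest_formula n i : (n + 2 <= 4 * i)%N -> (0 < n)%N ->
  ((Pnest n)`_i)%:~R =
    4 * (2 * i%:R + 1) * (8 * i%:R * (i%:R + 1) - 3 * (n%:R + 1))
    * ((2 * n + 1)`!)%:R
    * inv_fact (n%:Z - 2 * i%:Z + 1) * inv_fact (n%:Z + 2 * i%:Z + 3) :> rat.
Proof.
case: n => // r ri _; rewrite coef_Pnest_beta; last by lia.
(* Every inverse factorial is expressed through those of [x] and [y], the arguments in the closed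
   formula; an identity between polynomials in [r] and [i] remains. *)
set y := r.+1%:Z - 2 * i%:Z + 1; set x := r.+1%:Z + 2 * i%:Z + 3.
have Ex : x%:~R = r%:R + 2 * i%:R + 4 :> rat.
  by rewrite /x -addn1 PoszD !rmorphD /= rmorphM /= -!pmulrn; ring.
have Ey : y%:~R = r%:R - 2 * i%:R + 2 :> rat.
  by rewrite /y -addn1 PoszD !rmorphD /= rmorphN rmorphM /= -!pmulrn; ring.
rewrite !betaE.
have -> : r%:Z + (2 * i%:Z - 2) = x - 6%N%:Z by lia.
have -> : r%:Z - (2 * i%:Z - 2) = y - 0%N%:Z by lia.
have -> : r%:Z + 2 * i%:Z = x - 4%N%:Z by lia.
have -> : r%:Z - 2 * i%:Z = y - 2%N%:Z by lia.
have -> : r%:Z + (2 * i%:Z + 2) = x - 2%N%:Z by lia.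
have -> : r%:Z - (2 * i%:Z + 2) = y - 4%N%:Z by lia.
have -> : r%:Z + (2 * i%:Z + 4) = x - 0%N%:Z by lia.
have -> : r%:Z - (2 * i%:Z + 4) = y - 6%N%:Z by lia.
rewrite !inv_factB !big_ord_recr !big_ord0 /= Ex Ey.
have -> : (2 * r.+1 + 1 = (2 * r).+3)%N by lia.
rewrite 3!factS !natrM -![(_.+1)%:R]natr1 natrM.
ring.
Qed.

Lemma coef_PnestC_formula n i : (n + 3 <= 4 * i)%N -> (0 < n)%N ->
  ((PnestC n)`_i)%:~R =
    8 * i%:R * (8 * i%:R ^+ 2 * (2 * n%:R - 1) - (6 * n%:R ^+ 2 + n%:R - 2))
    * ((2 * n - 2)`!)%:R
    * inv_fact (n%:Z - 2 * i%:Z + 1) * inv_fact (n%:Z + 2 * i%:Z + 1) :> rat.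
Proof.
case: n => // r ri _; rewrite coef_PnestC_beta; last by lia.
set y := r.+1%:Z - 2 * i%:Z + 1; set x := r.+1%:Z + 2 * i%:Z + 1.
have Ex : x%:~R = r%:R + 2 * i%:R + 2 :> rat.
  by rewrite /x -addn1 PoszD !rmorphD /= rmorphM /= -!pmulrn; ring.
have Ey : y%:~R = r%:R - 2 * i%:R + 2 :> rat.
  by rewrite /y -addn1 PoszD !rmorphD /= rmorphN rmorphM /= -!pmulrn; ring.
rewrite !betaE.
have -> : r%:Z + (2 * i%:Z - 2) = x - 4%N%:Z by lia.
have -> : r%:Z - (2 * i%:Z - 2) = y - 0%N%:Z by lia.
have -> : r%:Z + (2 * i%:Z - 1) = x - 3%N%:Z by lia.
have -> : r%:Z - (2 * i%:Z - 1) = y - 1%N%:Z by lia.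
have -> : r%:Z + (2 * i%:Z + 1) = x - 1%N%:Z by lia.
have -> : r%:Z - (2 * i%:Z + 1) = y - 3%N%:Z by lia.
have -> : r%:Z + (2 * i%:Z + 2) = x - 0%N%:Z by lia.
have -> : r%:Z - (2 * i%:Z + 2) = y - 4%N%:Z by lia.
rewrite !inv_factB !big_ord_recr !big_ord0 /= Ex Ey.
have -> : (2 * r.+1 - 2 = 2 * r)%N by lia.
rewrite -![(_.+1)%:R]natr1.
ring.
Qed.

(** * Coefficients at the top index *)

Lemma beta_gt r (d : int) : r%:Z < d -> beta r d = 0.
Proof.
move=> rd; rewrite betaE; have : r%:Z - d < 0 by lia.
by case: (r%:Z - d) => // m _; rewrite mulr0.
Qed.

Lemma beta_max r : beta r r%:Z = 1.
Proof.
rewrite betaE subrr -PoszD addnn -mul2n /= invr1 mulr1 mulfV // pnatr_eq0.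
by rewrite -lt0n fact_gt0.
Qed.

Lemma beta_pred r : beta r (r%:Z - 1) = 2 * r%:R.
Proof.
rewrite betaE; have -> : r%:Z + (r%:Z - 1) = (2 * r)%N%:Z - 1 by lia.
have -> : r%:Z - (r%:Z - 1) = 1 by lia.
rewrite inv_factB1 /= invr1 mulr1 mulrCA mulfV ?mulr1 -?pmulrn ?natrM //.
by rewrite pnatr_eq0 -lt0n fact_gt0.
Qed.

(** [beta r] vanishes beyond [r], so only the first term survives: [beta r r] or [beta r (r - 1)]
    according to parity. *)
Lemma coef_Pnest_top n : (0 < n)%N ->
  (Pnest n)`_(ceil_div n 2) = if odd n then 1 else 2 * (n%:Z - 1).
Proof.
case: n => // r _; apply: (@intr_inj rat); have := odd_double_half r.+1.
rewrite /ceil_div; case: ifP => _; set m := r.+1./2 => rm.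
  have -> : ((r.+1 + 1) %/ 2 = m.+1)%N by lia.
  rewrite coef_Pnest_beta; last by lia.
  have -> : 2 * m.+1%:Z - 2 = r by lia.
  by rewrite beta_max !beta_gt; [ring|lia..].
have -> : ((r.+1 + 1) %/ 2 = m)%N by lia.
rewrite coef_Pnest_beta; last by lia.
have -> : 2 * m%:Z - 2 = r%:Z - 1 by lia.
rewrite beta_pred !beta_gt; [|lia..].
have -> : r.+1%:Z - 1 = r%:Z by lia.
rewrite rmorphM /= -!pmulrn; ring.
Qed.

(** For [n = 2] the index is 1, outside the range of the formula in [beta], and the coefficient is 1
    instead of 0. *)
Lemma coef_PnestC_top n : (0 < n)%N -> n <> 2%N ->
  (PnestC n)`_(ceil_div n 2) = if odd n then 1 else 2 * (n%:Z - 2).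
Proof.
case: n => // r _ n2; apply: (@intr_inj rat); have := odd_double_half r.+1.
rewrite /ceil_div; case: ifP => _; set m := r.+1./2 => rm.
  have -> : ((r.+1 + 1) %/ 2 = m.+1)%N by lia.
  rewrite coef_PnestC_beta; last by lia.
  have -> : 2 * m.+1%:Z - 2 = r by lia.
  by rewrite beta_max !beta_gt; [ring|lia..].
have -> : ((r.+1 + 1) %/ 2 = m)%N by lia.
rewrite coef_PnestC_beta; last by lia.
have -> : 2 * m%:Z - 2 = r%:Z - 1 by lia.
have -> : 2 * m%:Z - 1 = r%:Z by lia.
rewrite beta_pred beta_max !beta_gt; [|lia..].
have -> : r.+1%:Z - 2 = r%:Z - 1 by lia.
rewrite rmorphM rmorphB /= -!pmulrn; ring.
Qed.

(** * Log-concavity *)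

(** Nonnegativity of the outer terms is included to make the notion stable under termwise
    products. *)
Definition log_concave3 (x y z : rat) := [/\ 0 <= x, 0 <= z & x * z <= y ^+ 2].

Lemma log_concave3_le x y z : log_concave3 x y z -> x * z <= y ^+ 2.
Proof. by case. Qed.

Lemma log_concave3_const c : 0 <= c -> log_concave3 c c c.
Proof. by []. Qed.

Lemma log_concave3M x y z x' y' z' : log_concave3 x y z -> log_concave3 x' y' z' ->
  log_concave3 (x * x') (y * y') (z * z').
Proof.
case=> x0 z0 xz [x0' z0' xz']; split; rewrite ?mulr_ge0 //.
by rewrite mulrACA exprMn ler_pM ?mulr_ge0.
Qed.

Lemma inv_fact_ge0 z : 0 <= inv_fact z.
Proof. by case: z => m //=; rewrite invr_ge0 ler0n. Qed.

(** The step is 2 because [i] enters the factorials as [2 * i]. For [z >= 0] the claim reduces to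
    z(z - 1) <= (z + 1)(z + 2); for negative [z] both sides are 0. *)
Lemma log_concave3_inv_fact z :
  log_concave3 (inv_fact (z + 2)) (inv_fact z) (inv_fact (z - 2)).
Proof.
split; rewrite ?inv_fact_ge0 //.
have E : inv_fact z = (z%:~R + 1) * (z%:~R + 2) * inv_fact (z + 2).
  by rewrite inv_factS inv_factS -addrA !rmorphD /= mulrA.
rewrite expr2 {1}E; have -> : z - 2 = z - 2%N%:Z by [].
rewrite inv_factB !big_ord_recr big_ord0 /=.
have H := inv_fact_ge0 (z + 2); have H' := inv_fact_ge0 z.
have HH := mulr_ge0 H H'.
case: z {E} H H' HH => m H H' HH; last by rewrite [inv_fact (Negz m)]/= !mulr0.
rewrite -pmulrn; have m0 : 0 <= m%:R :> rat by rewrite ler0n.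
rewrite -subr_ge0.
have -> : (m%:R + 1) * (m%:R + 2) * inv_fact (m + 2) * inv_fact m
   - inv_fact (m + 2) * (1 * (m%:R - 0) * (m%:R - 1) * inv_fact m)
   = (4 * m%:R + 2) * (inv_fact (m%:Z + 2) * inv_fact m) :> rat by ring.
by rewrite mulr_ge0 //; lra.
Qed.

Lemma log_concave3_sym x y z : log_concave3 x y z -> log_concave3 z y x.
Proof. by case=> x0 z0 xz; split; rewrite // mulrC. Qed.

(** Meant for the quadratic factor of the connected formula at three consecutive indices, with m =
    2n - 1. *)
Lemma log_concave3_quadratic (m c y : rat) : 0 <= m -> 0 <= c -> 0 <= y ->
    0 <= 8 * y ^+ 2 * m - c ->
  log_concave3 (8 * y ^+ 2 * m - c) (8 * (y + 1) ^+ 2 * m - c)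
    (8 * (y + 1 + 1) ^+ 2 * m - c).
Proof.
move=> m0 c0 y0 A0; have my0 := mulr_ge0 m0 y0; split; first exact: A0.
  have -> : 8 * (y + 1 + 1) ^+ 2 * m - c = (8 * y ^+ 2 * m - c) + 32 * (m * y) + 32 * m by ring.
  by lra.
rewrite -subr_ge0.
have -> : (8 * (y + 1) ^+ 2 * m - c) ^+ 2
    - (8 * y ^+ 2 * m - c) * (8 * (y + 1 + 1) ^+ 2 * m - c)
  = 8 * m * (2 * c + 8 * (m * (2 * y ^+ 2 + 4 * y + 1))) by ring.
have y20 := sqr_ge0 y.
by rewrite !(mulr_ge0, addr_ge0).
Qed.

(** Each factor of the closed formula is log-concave in [i]; the bound makes the formula valid
    already at [i - 1]. *)
Lemma coef_Pnest_log_concave n i : (0 < n)%N -> (n + 6 <= 4 * i)%N ->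
  (Pnest n)`_i.-1 * (Pnest n)`_i.+1 <= (Pnest n)`_i ^+ 2.
Proof.
case: i => [|i] n0 ni; first by lia.
rewrite -(ler_int rat) rmorphM rmorphXn /= !coef_Pnest_formula; [|lia..].
apply: log_concave3_le.
have ni' : (n%:R + 2 <= 4 * i%:R :> rat).
  by rewrite -[2]/2%:R -natrD -[4]/4%:R -natrM ler_nat; lia.
have n0' : (1 <= n%:R :> rat) by rewrite ler1n.
apply: (log_concave3M (log_concave3M (log_concave3M
  (log_concave3M (log_concave3M _ _) _) _) _) _).
- exact: log_concave3_const.
- by rewrite -!natr1; split; [lra|lra|nra].
- by rewrite -!natr1; split; [nra|nra|nra].
- exact: log_concave3_const.
- have := log_concave3_inv_fact (n%:Z - 2 * i.+1%:Z + 1).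
  have -> : n%:Z - 2 * i.+1%:Z + 1 + 2 = n%:Z - 2 * i%:Z + 1 by lia.
  by have -> : n%:Z - 2 * i.+1%:Z + 1 - 2 = n%:Z - 2 * i.+2%:Z + 1 by lia.
have := log_concave3_sym (log_concave3_inv_fact (n%:Z + 2 * i.+1%:Z + 3)).
have -> : n%:Z + 2 * i.+1%:Z + 3 + 2 = n%:Z + 2 * i.+2%:Z + 3 by lia.
by have -> : n%:Z + 2 * i.+1%:Z + 3 - 2 = n%:Z + 2 * i%:Z + 3 by lia.
Qed.

Lemma coef_PnestC_log_concave n i : (0 < n)%N -> (n + 7 <= 4 * i)%N ->
  (PnestC n)`_i.-1 * (PnestC n)`_i.+1 <= (PnestC n)`_i ^+ 2.
Proof.
case: i => [|i] n0 ni; first by lia.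
rewrite -(ler_int rat) rmorphM rmorphXn /= !coef_PnestC_formula; [|lia..].
apply: log_concave3_le.
have ni' : (n%:R + 3 <= 4 * i%:R :> rat).
  by rewrite -[3]/3%:R -natrD -[4]/4%:R -natrM ler_nat; lia.
have n0' : (1 <= n%:R :> rat) by rewrite ler1n.
apply: (log_concave3M (log_concave3M (log_concave3M
  (log_concave3M (log_concave3M _ _) _) _) _) _).
- exact: log_concave3_const.
- by rewrite -!natr1; split; [lra|lra|nra].
- rewrite -!natr1; move: (n%:R) (i%:R) ni' n0' => x y xy x1.
  have c0 : 0 <= 6 * x ^+ 2 + x - 2 by nra.
  have y2 : (x + 3) ^+ 2 <= 16 * y ^+ 2 by nra.
  (* At the smallest of the three indices, 16 y^2 >= (x + 3)^2 bounds the factor below by a cubic in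
     [x], nonnegative for x >= 1. *)
  have A0 : 0 <= 8 * y ^+ 2 * (2 * x - 1) - (6 * x ^+ 2 + x - 2).
    have := ler_wpM2r (_ : 0 <= 2 * x - 1) y2; have : 0 <= (x - 1) * x ^+ 2 by nra.
    by move=> H1 H2; have := H2 ltac:(lra); lra.
  by apply: log_concave3_quadratic; [lra|exact: c0|lra|exact: A0].
- exact: log_concave3_const.
- have := log_concave3_inv_fact (n%:Z - 2 * i.+1%:Z + 1).
  have -> : n%:Z - 2 * i.+1%:Z + 1 + 2 = n%:Z - 2 * i%:Z + 1 by lia.
  by have -> : n%:Z - 2 * i.+1%:Z + 1 - 2 = n%:Z - 2 * i.+2%:Z + 1 by lia.
have := log_concave3_sym (log_concave3_inv_fact (n%:Z + 2 * i.+1%:Z + 1)).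
have -> : n%:Z + 2 * i.+1%:Z + 1 + 2 = n%:Z + 2 * i.+2%:Z + 1 by lia.
by have -> : n%:Z + 2 * i.+1%:Z + 1 - 2 = n%:Z + 2 * i%:Z + 1 by lia.
Qed.

(** * Walks of height at most 2 *)

(** Every step is a stay at 1; two pairs realise it, and only one of them in the connected case. *)
Lemma nwalks_1 b r : nwalks b r 1 = (if b then 1 else 2 ^ r)%N.
Proof.
rewrite /nwalks /=; elim: r => [|r IHr]; first by rewrite walks0; case: (b).
rewrite walksS !big_bool /= subnn subn0 !addn0 !add0n !addn1 IHr expnS.
by case: (b); rewrite /= ?mul0n; lia.
Qed.

(** Walks from 1 and from 2 are treated together: the sum of their numbers triples at each step and
    the difference remains 1. *)
Lemma nwalks_2 r : (2 * nwalks false r 2 = 3 ^ r + 1)%N.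
Proof.
rewrite /nwalks /=; suff [] : (2 * walks 0 2 r 1 = 3 ^ r + 1 /\
  2 * walks 0 2 r 2 + 1 = 3 ^ r)%N by [].
elim: r => [|r [IH1 IH2]]; first by rewrite !walks0.
rewrite expnS !walksS !big_bool /= !(subn0, addn0, subSS, addn1, add1n) ?subnn; split; lia.
Qed.

(** The numbers of walks from 1 and from 2 are consecutive Fibonacci numbers. The case [r = 0] is
    F_{-1} = 1, so the induction on [fib] starts at length 1. *)
Lemma nwalks_2_connected r : (nwalks true r 2)%:Z = fibz (2 * r%:Z - 1).
Proof.
rewrite /nwalks /=; case: r => [|r]; first by rewrite walks0.
have -> : 2 * r.+1%:Z - 1 = (2 * r).+1 by lia.
suff [-> _] : (walks 1 2 r.+1 1 = fib (2 * r).+1 /\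
  walks 1 2 r.+1 2 = fib (2 * r).+2)%N by [].
elim: r => [|r [IH1 IH2]]; first by rewrite !walksS !big_bool /= !walks0.
have F s : fib s.+2 = (fib s.+1 + fib s)%N by [].
have -> : (2 * r.+1 = (2 * r).+2)%N by lia.
rewrite [fib _.+4]F ![fib _.+3]F -IH1 -IH2 walksS [walks _ _ _.+2 2]walksS !big_bool /=.
by rewrite !(subn0, addn0, subSS, addn1, add1n) ?subnn; split; lia.
Qed.

(** * Stirling numbers through surjections *)

Definition surjective (n k : nat) (f : {ffun 'I_n -> 'I_k}) : bool :=
  [forall c, [exists x, f x == c]].

(** The fibres of a surjection onto [k] points form a partition into [k] blocks together with an
    ordering of the blocks. *)
Lemma card_surjective n k :
  #|[set f : {ffun 'I_n -> 'I_k} | surjective f]| = (stirling2 n k * k`!)%N.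
Proof.
pose fibers (f : {ffun 'I_n -> 'I_k}) := [tuple f @^-1: [set c] | c < k].
have fibersE f x c : (x \in tnth (fibers f) c) = (f x == c).
  by rewrite tnth_mktuple !inE.
have fibers_inj : injective fibers.
  move=> f g fg; apply/ffunP => x; apply/eqP.
  by rewrite eq_sym -fibersE -fg fibersE.
rewrite -(card_imset _ fibers_inj).
pose Z := [set t : k.-tuple {set 'I_n} | uniq t & partition [set:: t] [set: 'I_n]].
have -> : fibers @: [set f | surjective f] = Z.
  apply/setP => t; apply/imsetP/idP => [[f]|].
    rewrite inE => /forallP fs ->.
    have nempty c : exists x, x \in tnth (fibers f) c.
      by have /existsP[x] := fs c; rewrite -fibersE; exists x.
    rewrite inE; apply/andP; split.
      apply/tuple_uniqP => c c' E; have [x xc] := nempty c.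
      by move: (xc); rewrite E; move: xc; rewrite !fibersE => /eqP<- /eqP.
    apply/and3P; split.
    - apply/eqP/setP => x; rewrite inE; apply/bigcupP; exists (tnth (fibers f) (f x)).
        by rewrite inE mem_tnth.
      by rewrite fibersE.
    - apply/trivIsetP => A B; rewrite !inE => /tnthP[c ->] /tnthP[c' ->] nAB.
      apply/pred0P => x /=; apply/negP => /andP[]; rewrite !fibersE => /eqP E /eqP E'.
      by rewrite -E -E' eqxx in nAB.
    rewrite inE; apply/negP => /tnthP[c E]; have [x] := nempty c.
    by rewrite -E inE.
  rewrite inE => /andP[/tuple_uniqP tinj /and3P[/eqP cov /trivIsetP triv ne]].
  have ex x : exists c, x \in tnth t c.
    have : x \in cover [set:: t] by rewrite cov inE.
    by case/bigcupP => A; rewrite inE => /tnthP[c ->] xc; exists c.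
  pose f := [ffun x => xchoose (ex x)].
  have fE x c : (f x == c) = (x \in tnth t c).
    rewrite ffunE; apply/eqP/idP => [<-|xc]; first exact: (xchooseP (ex x)).
    apply/tinj/eqP; apply: contraT => nAB.
    have := triv _ _ _ _ nAB; rewrite !inE !mem_tnth => /(_ isT isT).
    by move/pred0P/(_ x); rewrite /= xc (xchooseP (ex x)).
  exists f.
    rewrite inE; apply/forallP => c; apply/existsP.
    have /set0Pn[x xc] : tnth t c != set0.
      by apply: contraNneq ne => <-; rewrite inE mem_tnth.
    by exists x; rewrite fE.
  apply/eq_from_tnth => c; apply/setP => x.
  by rewrite fibersE fE.
(* The tuples are grouped by their underlying set of blocks, each of which has k! orderings. *)
rewrite -sum1_card (partition_big (fun t : k.-tuple _ => [set:: t])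
  (mem [set P : {set {set 'I_n}} | partition P [set: 'I_n] & #|P| == k])) /=; last first.
  move=> t; rewrite !inE => /andP[ut ->] /=.
  by rewrite cardsE (card_uniqP ut) size_tuple.
rewrite -[LHS]muln1 /stirling2 -sum_nat_const muln1; apply: eq_bigr => P.
rewrite inE => /andP[partP /eqP cardP].
rewrite sum1_card -ffactnn -[X in X ^_ _]cardP -card_uniq_tuples cardsE.
apply: eq_card => t; rewrite -[LHS]/((t \in Z) && ([set:: t] == P)) inE.
rewrite -[RHS]/(all (fun A => A \in P) t && uniq t); apply/andP/andP.
  case=> /andP[ut _] /eqP<-; split=> //; apply/allP => A At.
  by rewrite inE.
case=> /allP tP ut; suff E : [set:: t] = P by rewrite E partP ut eqxx.
apply/eqP; rewrite eqEcard cardP cardsE (card_uniqP ut) size_tuple leqnn andbT.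
by apply/subsetP => A; rewrite inE => /tP.
Qed.

(** Inclusion-exclusion over the missed values, with the negative terms moved across. Three values
    cannot be missed at once, as [n] is positive. *)
Lemma card_surjective3 n : (0 < n)%N ->
  (#|[set f : {ffun 'I_n -> 'I_3} | surjective f]| + 3 * 2 ^ n = 3 ^ n + 3)%N.
Proof.
move=> n0.
pose hits (f : {ffun 'I_n -> 'I_3}) c := [exists x, f x == c].
have avoid (A : {set 'I_3}) :
    (\sum_f [forall c in A, ~~ hits f c] = (3 - #|A|) ^ n)%N.
  have -> : (3 - #|A| = #|[predC A]|)%N by rewrite -(addKn #|A| #|[predC A]|) cardC card_ord.
  rewrite -[n in RHS]card_ord -card_ffun_on -big_mkcond sum1_card.
  apply: eq_card => f; apply/forallP/ffun_onP => /= [H x|H c].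
    rewrite !inE; apply/negP => fA; have := H (f x); rewrite fA /=.
    by move/negP; apply; apply/existsP; exists x.
  apply/implyP => cA; apply/negP => /existsP[x /eqP fx].
  by have := H x; rewrite fx !inE cA.
have avoid1 c : (\sum_f ~~ hits f c = 2 ^ n)%N.
  have := avoid [set c]; rewrite cards1 => E.
  apply: etrans E; apply: eq_bigr => f _; congr nat_of_bool.
  by apply/idP/forall_inP => [nc c'|]; [rewrite inE => /eqP->|apply; rewrite inE].
have avoid2 c c' : c != c' -> (\sum_f (~~ hits f c && ~~ hits f c') = 1)%N.
  move=> cc'; have := avoid [set c; c'].
  rewrite cards2 cc' -[(3 - _)%N]/1%N exp1n => E.
  apply: etrans E; apply: eq_bigr => f _; congr nat_of_bool.
  apply/andP/forall_inP => [[nc nc'] c2|H]; first by rewrite !inE => /orP[] /eqP->.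
  by split; apply: H; rewrite !inE eqxx ?orbT.
pose o0 : 'I_3 := ord0; pose o1 : 'I_3 := lift ord0 ord0.
pose o2 : 'I_3 := lift ord0 (lift ord0 ord0).
have ord3 c : [\/ c = o0, c = o1 | c = o2].
  by case: c => -[|[|[|//]]] c3; [apply: Or31|apply: Or32|apply: Or33]; apply/val_inj.
have total : (\sum_(f : {ffun 'I_n -> 'I_3}) 1 = 3 ^ n)%N.
  by rewrite sum1_card card_ffun !card_ord.
(* With m missed values the summands satisfy [m = 0] + m = 1 + m(m - 1)/2, true for m up to 2. *)
have : (\sum_(f : {ffun 'I_n -> 'I_3})
    (surjective f + (~~ hits f o0 + ~~ hits f o1 + ~~ hits f o2)) =
  \sum_f (1 + ((~~ hits f o0 && ~~ hits f o1) + (~~ hits f o0 && ~~ hits f o2)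
    + (~~ hits f o1 && ~~ hits f o2))))%N; last first.
  rewrite !big_split /= !avoid1 !avoid2 // total -big_mkcond sum1_card cardsE.
  by move=> E; lia.
apply: eq_bigr => f _.
have -> : surjective f = [&& hits f o0, hits f o1 & hits f o2].
  apply/forallP/and3P => [H|[h0 h1 h2] c]; first by split; apply: H.
  by case: (ord3 c) => ->.
have : [|| hits f o0, hits f o1 | hits f o2].
  have : hits f (f (Ordinal n0)) by apply/existsP; exists (Ordinal n0).
  by case: (ord3 (f (Ordinal n0))) => -> ->; rewrite ?orbT.
by case: (hits f o0); case: (hits f o1); case: (hits f o2).
Qed.

Lemma stirling2_3 n : (0 < n)%N -> (2 * stirling2 n 3 + 2 ^ n = 3 ^ n.-1 + 1)%N.
Proof.
case: n => // n n0; have := card_surjective3 n0; rewrite card_surjective !expnS /=.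
have -> : (3`! = 6)%N by []. lia.
Qed.

Theorem corollary3p15 (n : nat) (n_ge1 : (1 <= n)%N) :
  ((Pnest n)`_1 = 2 ^+ n.-1 /\ (PnestC n)`_1 = 1) /\
  ((Pnest n)`_2 = (stirling2 n 3)%:Z /\
   (PnestC n)`_2 = fibz (2 * n%:Z - 3) - 1) /\
  ((forall i : nat, (ceil_div (n + 2) 4 <= i)%N ->
      ((Pnest n)`_i)%:~R =
        4 * (2 * i%:R + 1) * (8 * i%:R * (i%:R + 1) - 3 * (n%:R + 1))
        * ((2 * n + 1)`!)%:R
        * inv_fact (n%:Z - 2 * i%:Z + 1)
        * inv_fact (n%:Z + 2 * i%:Z + 3) :> rat) /\
   (Pnest n)`_(ceil_div n 2) = (if odd n then 1 else 2 * (n%:Z - 1))) /\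
  ((forall i : nat, ((n + 2) %/ 4 < i)%N ->
      ((PnestC n)`_i)%:~R =
        8 * i%:R
        * (8 * i%:R ^+ 2 * (2 * n%:R - 1) - (6 * n%:R ^+ 2 + n%:R - 2))
        * ((2 * n - 2)`!)%:R
        * inv_fact (n%:Z - 2 * i%:Z + 1)
        * inv_fact (n%:Z + 2 * i%:Z + 1) :> rat) /\
   (n <> 2%N ->
    (PnestC n)`_(ceil_div n 2) = (if odd n then 1 else 2 * (n%:Z - 2)))) /\
  (forall i : nat, (ceil_div (n + 2) 4 < i <= ceil_div n 2)%N ->
     (Pnest n)`_i ^+ 2 >= (Pnest n)`_i.-1 * (Pnest n)`_i.+1) /\
  (forall i : nat, ((n + 2) %/ 4 + 1 < i <= ceil_div n 2)%N ->
     (PnestC n)`_i ^+ 2 >= (PnestC n)`_i.-1 * (PnestC n)`_i.+1).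
Proof.
case: n n_ge1 => // r _; split; [|split; [|split; [|split; [|split]]]].
- by rewrite coef_Pnest coef_PnestC !nwalks_1 /= !subr0 -[X in X = _ /\ _]natz natrX.
- rewrite coef_Pnest coef_PnestC nwalks_2_connected !nwalks_1; split.
    (* Both sides, doubled, equal 3^r + 1 - 2^(r+1). *)
    by have := @stirling2_3 r.+1 isT; have := nwalks_2 r; rewrite expnS /=; lia.
  by congr (fibz _ - _); lia.
- split; last exact: coef_Pnest_top.
  by move=> i; rewrite /ceil_div => ni; apply: coef_Pnest_formula; lia.
- split; last exact: coef_PnestC_top.
  by move=> i ni; apply: coef_PnestC_formula; lia.
- by move=> i; rewrite /ceil_div => ni; apply: coef_Pnest_log_concave; lia.
- by move=> i ni; apply: coef_PnestC_log_concave; lia.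
Qed.
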